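(* In the single-peaked domain, the communication complexity of the problem CheckPO is $\Omega(n)$, where $n$ is the number of agents (and of resources).
   Context: Setting. $\mathcal{N}=\{a_1,\dots,a_n\}$ is a set of $n$ agents and $\mathcal{R}$ a set of $n$ resources. An allocation $\pi$ assigns to each agent $a_i$ a single resource $\pi_{a_i}\in\mathcal{R}$, distinct agents getting distinct resources. Each agent $a_i$ has a strict linear order $\succ_i$ over $\mathcal{R}$; $L=\langle\succ_i\rangle_{a_i\in\mathcal{N}}$. An instance is $I=\langle\mathcal{N},\mathcal{R},L,\pi^0\rangle$ with $\pi^0$ an initial allocation. Single-peakedness. Given a linear order (axis) $\lhd$ on $\mathcal{R}$, a linear order $\succ$ on $\mathcal{R}$ with top resource $top(\succ)$ is single-peaked with respect to $\lhd$ if for all $r,r'\in\mathcal{R}$ with $r'\lhd r\lhd top(\succ)$ or $top(\succ)\lhd r\lhd r'$ one has $r\succ r'$. The instance is single-peaked with respect to $\lhd$ if all $\succ_i$ are. Pareto-optimality. $\pi$ is Pareto-optimal if there is no allocation $\pi'$ such that every agent $a_i$ has $\pi'_{a_i}\succ_i\pi_{a_i}$ or $\pi'_{a_i}=\pi_{a_i}$, and at least one agent $a_j$ has $\pi'_{a_j}\succ_j\pi_{a_j}$. CheckPO. Given an instance $I=\langle\mathcal{N},\mathcal{R},L,\pi^0\rangle$ that is single-peaked with respect to an axis $\lhd$, answer yes if and only if $\pi^0$ is Pareto-optimal. Communication model. The axis $\lhd$ and the allocation $\pi^0$ are known to everybody, and the private input of agent $a_i$ is her single-peaked order $\succ_i$.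 The (deterministic, multi-party) communication complexity is the minimum, over all deterministic protocols in which the agents exchange bits and which correctly compute the answer of CheckPO for every single-peaked profile $L$, of the worst-case total number of bits communicated by the agents. *)

(* Defs.v *)
From mathcomp Require Import all_boot all_order all_algebra.
From mathcomp Require Import boolp.

Set Implicit Arguments.
Unset Strict Implicit.
Unset Printing Implicit Defensive.

Definition strict_linear_order (T : eqType) (lt : rel T) : Prop :=
  [/\ irreflexive lt, transitive lt & forall x y, x != y -> lt x y \/ lt y x].

(* Orders are strict, and a preference [pref r s] reads "r is preferred to s";
   an axis [axis r s] reads "r is to the left of s". *)
Definition is_top (R : eqType) (pref : rel R) (t : R) : Prop :=
  forall r, r != t -> pref t r.

(* A linear order on a nonempty finite type has exactly one top. *)
Definition single_peaked (R : eqType) (axis pref : rel R) : Prop :=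
  forall t, is_top pref t ->
  forall r r', (axis r' r /\ axis r t) \/ (axis t r /\ axis r r') -> pref r r'.

Definition single_peaked_profile (n : nat) (R : eqType) (axis : rel R)
    (L : 'I_n -> rel R) : Prop :=
  forall i, strict_linear_order (L i) /\ single_peaked axis (L i).

(* Allocations are the injective maps from agents to resources. *)
Definition pareto_optimal (n : nat) (R : eqType) (L : 'I_n -> rel R)
    (alloc : 'I_n -> R) : Prop :=
  ~ exists alloc' : 'I_n -> R,
      [/\ injective alloc',
          forall i, L i (alloc' i) (alloc i) \/ alloc' i = alloc i
        & exists j, L j (alloc' j) (alloc j)].

(* Deterministic number-in-hand protocols over a shared blackboard: agents are
   indexed by [I] and each holds an input in [X].  The bits written so far
   determine whether the protocol stops, with which answer, and otherwise who
   writes the next bit, which is a function [m] of that agent's own input. *)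
Inductive protocol (I X : Type) : Type :=
| Answer of bool
| Speak (i : I) (m : X -> bool) of bool -> protocol I X.
Arguments Answer {I X}.

Fixpoint output (I X : Type) (p : protocol I X) (L : I -> X) : bool :=
  match p with
  | Answer b => b
  | Speak i m next => output (next (m (L i))) L
  end.

Fixpoint bits (I X : Type) (p : protocol I X) (L : I -> X) : nat :=
  match p with
  | Answer _ => 0
  | Speak i m next => (bits (next (m (L i))) L).+1
  end.

(* The protocol may depend on [axis] and [alloc], which are public. *)
Definition solves_checkPO (n : nat) (R : eqType) (axis : rel R)
    (alloc : 'I_n -> R) (p : protocol 'I_n (rel R)) : Prop :=
  forall L, single_peaked_profile axis L ->
    output p L <-> pareto_optimal L alloc.

Definition checkPO_solvable_within (n : nat) (R : eqType) (axis : rel R)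
    (alloc : 'I_n -> R) (k : nat) : Prop :=
  exists2 p : protocol 'I_n (rel R), solves_checkPO axis alloc p
    & forall L, single_peaked_profile axis L -> bits p L <= k.

Section BroadcastProtocol.
Variables (n : nat) (R : finType).

Fixpoint broadcast (qs : seq ('I_n * R * R)) (known : seq ('I_n * R * R))
    (answer : seq ('I_n * R * R) -> bool) : protocol 'I_n (rel R) :=
  if qs is q :: qs' then
    Speak q.1.1 (fun pref => pref q.1.2 q.2)
      (fun b => broadcast qs' (if b then q :: known else known) answer)
  else Answer (answer known).

Lemma output_broadcast qs known answer (L : 'I_n -> rel R) :
  output (broadcast qs known answer) L =
  answer (catrev [seq q <- qs | L q.1.1 q.1.2 q.2] known).
Proof. by elim: qs known => //= q qs IH known; rewrite IH; case: ifP. Qed.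

Lemma bits_broadcast qs known answer (L : 'I_n -> rel R) :
  bits (broadcast qs known answer) L = size qs.
Proof. by elim: qs known => //= q qs IH known; rewrite IH. Qed.

Lemma checkPO_solvable (axis : rel R) (alloc : 'I_n -> R) :
  exists k, `[< checkPO_solvable_within axis alloc k >].
Proof.
pose qs := enum {: 'I_n * R * R}.
pose answer (s : seq ('I_n * R * R)) :=
  `[< pareto_optimal (fun (i : 'I_n) r r' => (i, r, r') \in s) alloc >].
exists (size qs); apply/asboolP; exists (broadcast qs [::] answer) => L _; last first.
  by rewrite bits_broadcast.
rewrite output_broadcast -/(rev _) /answer.
set L' := (X in pareto_optimal X _).
have -> : L' = L.
  apply/funext => i; apply/funext => r; apply/funext => r'.
  by rewrite /L' mem_rev mem_filter mem_enum andbT.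
by split => /asboolP.
Qed.

End BroadcastProtocol.

(* The least worst-case number of bits of a correct protocol. *)
Definition checkPO_complexity (n : nat) (R : finType) (axis : rel R)
    (alloc : 'I_n -> R) : nat :=
  ex_minn (checkPO_solvable axis alloc).

(* Main.v *)
(* Pair the agents whose initial resources occupy positions 2k and 2k+1 of the
   axis.  For a set x of pairs, let both agents of pair k have the same peak:
   position 2k+1 if k is in x and 2k otherwise; the agent at 2k ranks everything
   left of her peak before everything right of it, and the agent at 2k+1 does
   the opposite.  Then exactly one agent of each pair wants to move, to the
   resource of her partner, who already holds her top: every such profile is
   Pareto-optimal.  If x and y differ at pair k, one can give the agent at 2k
   her order from one of the two profiles and the agent at 2k+1 hers from the
   other so that both want to swap.  The profiles thus form a fooling set of
   size 2 ^ (n / 2). *)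
Require Import Defs.
From mathcomp Require Import all_boot all_order all_algebra.
From mathcomp Require Import boolp perm zify lra.

Import Order.TTheory GRing.Theory Num.Theory.
Local Open Scope ring_scope.

Set Implicit Arguments.
Unset Strict Implicit.
Unset Printing Implicit Defensive.

(** Induction on [p]: the first bit splits [S] into two halves. A mixture of two profiles from one
    half sends the same bit, as the speaker's input comes from one of them, so each half is again a
    fooling set. At a leaf the answer is constant, so two distinct elements cannot coexist. *)
Lemma fooling_set_bound (I X : Type) (T : finType) (p : protocol I X)
    (F : T -> I -> X) (S : {set T}) (k : nat) :
  {in S, forall x, output p (F x)} ->
  {in S, forall x, (bits p (F x) <= k)%N} ->
  {in S &, forall x y, x != y -> exists2 L,
     forall i, L i = F x i \/ L i = F y i & ~~ output p L} ->
  (#|S| <= 2 ^ k)%N.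
Proof.
elim: p S k => [b | i m next IH] S k yes short fool.
  apply: leq_trans (_ : 1 <= _)%N; last by rewrite expn_gt0.
  apply/card_le1_eqP => x y xS yS; apply/eqP; apply: contraT => neq_xy.
  by have [L _ /=] := fool _ _ yS xS neq_xy; have /= -> := yes _ xS.
have [->|[x0 x0S]] := set_0Vmem S; first by rewrite cards0.
case: k short => [|k] short; first by have := short _ x0S.
pose half (b : bool) := [set x in S | m (F x i) == b].
have half_le b : (#|half b| <= 2 ^ k)%N.
  apply: (IH b) => [x | x | x y].
  - by rewrite inE => /andP[/yes /= + /eqP mx]; rewrite mx.
  - by rewrite inE => /andP[/short /= + /eqP mx]; rewrite mx ltnS.
  - rewrite !inE => /andP[xS /eqP mx] /andP[yS /eqP my] neq_xy.
    have [L mix noL] := fool _ _ xS yS neq_xy; exists L => //.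
    suff mL : m (L i) = b by rewrite /= mL in noL.
    by case: (mix i) => ->.
have -> : S = half true :|: half false.
  by apply/setP => x; rewrite !inE; case: (m _); rewrite ?andbT ?andbF ?orbF.
by rewrite (leq_trans (leq_card_setU _ _)) // expnS mul2n -addnn leq_add.
Qed.

(** The position of a resource is the number of resources to its left. *)
Lemma axis_position (R : finType) (axis : rel R) :
  strict_linear_order axis ->
  exists2 pos : R -> 'I_#|R|, bijective pos
    & forall r s, axis r s = (pos r < pos s)%N.
Proof.
case=> irr tr tot; pose below r := [set s | axis s r].
have below_lt r s : axis r s -> (#|below r| < #|below s|)%N.
  move=> rs; apply/proper_card/properP; split.
    by apply/subsetP => t; rewrite !inE => /tr; apply.
  by exists r; rewrite inE ?irr.
have below_max r : (#|below r| < #|R|)%N.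
  rewrite -cardsT; apply/proper_card/properP; split; first exact: subsetT.
  by exists r; rewrite !inE ?irr.
pose pos r := Ordinal (below_max r).
have pos_mono r s : axis r s = (pos r < pos s)%N.
  apply/idP/idP => [/below_lt // | lt_rs].
  have /tot [//|/below_lt] : r != s by apply: contraTneq lt_rs => ->; rewrite ltnn.
  by rewrite ltnNge ltnW.
exists pos => //; apply: inj_card_bij; last by rewrite card_ord.
move=> r s /(congr1 val) eq_pos; apply/eqP; apply: contraT => /tot.
by rewrite !pos_mono eq_pos ltnn; case.
Qed.

(* The rank of position [t] (smaller is better) in the order on [0, n) with peak
   [c] that exhausts the right side of the peak first if [b], and the left side
   first otherwise. *)
Definition peak_rank (n : nat) (b : bool) (c t : nat) : nat :=
  ((t - c) + (c - t) + if (if b then t < c else c < t) then n else 0)%N.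

(** Distances to the peak stay below [n], so the penalty [n] separates the two sides. *)
Lemma peak_rank_inj (n : nat) (b : bool) (c s t : nat) :
  (c < n)%N -> (s < n)%N -> (t < n)%N ->
  peak_rank n b c s = peak_rank n b c t -> s = t.
Proof. by rewrite /peak_rank; case: b; do 2![case: ifP]; lia. Qed.

Lemma peak_rank_peak (n : nat) (b : bool) (c : nat) : peak_rank n b c c = 0%N.
Proof. by rewrite /peak_rank subnn ltnn if_same. Qed.

Lemma peak_rank_single_peaked (n : nat) (b : bool) (c s t : nat) :
  (t < s /\ s < c)%N \/ (c < s /\ s < t)%N ->
  (peak_rank n b c s < peak_rank n b c t)%N.
Proof. by rewrite /peak_rank; case: b; do 2![case: ifP]; lia. Qed.

(** Here [q./2] is a plain number and may equal [m]: for odd [n] the last position is unpaired and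
    is then its own peak. *)
Definition pair_peak (m : nat) (x : {set 'I_m}) (q : nat) : nat :=
  (q./2.*2 + [exists k in x, k == q./2 :> nat])%N.

Lemma pair_peak_half (m : nat) (x : {set 'I_m}) (q : nat) :
  (pair_peak x q)./2 = q./2.
Proof. by rewrite /pair_peak addnC half_bit_double. Qed.

Lemma pair_peak_idem (m : nat) (x : {set 'I_m}) (q : nat) :
  pair_peak x (pair_peak x q) = pair_peak x q.
Proof. by rewrite {1 3}/pair_peak pair_peak_half. Qed.

Lemma pair_peak_lt (n : nat) (x : {set 'I_n./2}) (q : nat) :
  (q < n)%N -> (pair_peak x q < n)%N.
Proof.
rewrite /pair_peak; case: existsP => [[k /andP[_ /eqP kq]] | _] /=; last lia.
by have := ltn_ord k; lia.
Qed.

Lemma pair_peakE (m : nat) (x : {set 'I_m}) (k : 'I_m) (q : nat) :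
  q./2 = k -> pair_peak x q = (k.*2 + (k \in x))%N.
Proof.
move=> qk; rewrite /pair_peak qk; congr (_ + nat_of_bool _)%N.
by apply/existsP/idP => [[j /andP[jx /eqP/val_inj <-]] //|kx]; exists k; rewrite kx /=.
Qed.

Definition pair_rank (n : nat) (x : {set 'I_n./2}) (q : nat) : nat -> nat :=
  peak_rank n (odd q) (pair_peak x q).

(* An agent holds her first or second choice. *)
Lemma pair_rank_better (n : nat) (x : {set 'I_n./2}) (q t : nat) : (q < n)%N ->
  (pair_rank x q t < pair_rank x q q)%N -> t = pair_peak x q.
Proof.
by rewrite /pair_rank /peak_rank /pair_peak; case: [exists _ in _, _];
  case oq: (odd q); do 2![case: ifP]; lia.
Qed.

Section PairProfile.

Variables (n : nat) (R : finType) (axis : rel R) (pi0 : 'I_n -> R).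
Variable pos : R -> 'I_n.
Hypothesis pos_bij : bijective pos.
Hypothesis axisE : forall r s, axis r s = (pos r < pos s)%N.
Hypothesis pi0_bij : bijective pi0.

Definition pair_profile (x : {set 'I_n./2}) (i : 'I_n) : rel R :=
  fun r s => (pair_rank x (pos (pi0 i)) (pos r)
              < pair_rank x (pos (pi0 i)) (pos s))%N.

Lemma pair_profile_single_peaked (x : {set 'I_n./2}) (i : 'I_n) :
  strict_linear_order (pair_profile x i) /\ single_peaked axis (pair_profile x i).
Proof.
have peak_lt := pair_peak_lt x (ltn_ord (pos (pi0 i))).
split.
  split=> [r | s r t | r s neq_rs]; first by rewrite /pair_profile ltnn.
    exact: ltn_trans.
  apply/orP; rewrite -neq_ltn; apply: contraNneq neq_rs => eq_rank.
  apply/eqP/(bij_inj pos_bij)/val_inj.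
  by apply: peak_rank_inj eq_rank => //; apply: ltn_ord.
move=> t top r r'; have [res _ posK] := pos_bij.
rewrite !axisE; suff -> : pos t = Ordinal peak_lt.
  exact: peak_rank_single_peaked.
(* The peak has rank 0, so no other resource can be the top. *)
suff -> : t = res (Ordinal peak_lt) by rewrite posK.
apply/eqP; apply: contraT; rewrite eq_sym => /top.
by rewrite /pair_profile posK /pair_rank peak_rank_peak ltn0.
Qed.

Lemma pair_profile_pareto_optimal (x : {set 'I_n./2}) :
  pareto_optimal (pair_profile x) pi0.
Proof.
case=> alloc [alloc_inj weak [j better]].
have [own _ ownK] := pi0_bij.
have posE := pair_rank_better (ltn_ord _) better.
(* An improving agent [j] moves to her peak. Its initial holder has the same peak, hence must keep
   it, and injectivity of [alloc] makes her [j] herself. *)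
have pos_own : val (pos (pi0 (own (alloc j)))) =
    pair_peak x (pos (pi0 (own (alloc j)))).
  by rewrite ownK posE pair_peak_idem.
have /alloc_inj eq_own : alloc (own (alloc j)) = alloc j.
  case: (weak (own (alloc j))) => [|->]; last exact: ownK.
  by rewrite /pair_profile /pair_rank -pos_own peak_rank_peak ltn0.
have eq_alloc : alloc j = pi0 j by rewrite -[LHS]ownK eq_own.
by move: better; rewrite eq_alloc /pair_profile ltnn.
Qed.

Lemma pair_profile_mix (x y : {set 'I_n./2}) (k : 'I_n./2) :
  k \in x -> k \notin y ->
  ~ pareto_optimal
      (fun i => if odd (pos (pi0 i)) then pair_profile y i else pair_profile x i)
      pi0.
Proof.
move=> kx ky; have k_lt := ltn_ord k.
have lt0 : (k.*2 < n)%N by lia.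
have lt1 : (k.*2.+1 < n)%N by lia.
have [own piK ownK] := pi0_bij; have [res posK resK] := pos_bij.
pose i0 := own (res (Ordinal lt0)); pose i1 := own (res (Ordinal lt1)).
have pos0 : pos (pi0 i0) = k.*2 :> nat by rewrite ownK resK.
have pos1 : pos (pi0 i1) = k.*2.+1 :> nat by rewrite ownK resK.
have px : pair_peak x k.*2 = k.*2.+1.
  by rewrite (pair_peakE _ (k := k)) ?doubleK // kx addn1.
have py : pair_peak y k.*2.+1 = k.*2.
  by rewrite (pair_peakE _ (k := k)) ?(negPf ky) ?addn0 //; lia.
have odd0 : odd k.*2 = false by lia.
have odd1 : odd k.*2.+1 by lia.
(* Swapping pair [k] gives both agents their tops: [i0] follows [x] with peak [k.*2.+1], [i1]
   follows [y] with peak [k.*2]. *)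
case; exists (pi0 \o tperm i0 i1); split.
- exact: inj_comp (bij_inj pi0_bij) perm_inj.
- move=> i /=; case: tpermP => [->|->|_ _]; [left | left | by right].
    rewrite pos0 odd0 /pair_profile /pair_rank pos0 pos1 px odd0 /peak_rank.
    by do 2![case: ifP]; lia.
  rewrite pos1 odd1 /pair_profile /pair_rank pos0 pos1 py odd1 /peak_rank.
  by do 2![case: ifP]; lia.
- exists i0; rewrite /= tpermL.
  rewrite pos0 odd0 /pair_profile /pair_rank pos0 pos1 px odd0 /peak_rank.
  by do 2![case: ifP]; lia.
Qed.

Lemma pair_profile_bound (k : nat) :
  checkPO_solvable_within axis pi0 k -> (n./2 <= k)%N.
Proof.
case=> p solves short.
have sp x : single_peaked_profile axis (pair_profile x).
  by move=> i; apply: pair_profile_single_peaked.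
have mix (x y : {set 'I_n./2}) : ~~ (x \subset y) -> exists2 L,
    forall i, L i = pair_profile x i \/ L i = pair_profile y i & ~~ output p L.
  case/subsetPn => j jx jy.
  exists (fun i =>
    if odd (pos (pi0 i)) then pair_profile y i else pair_profile x i).
    by move=> i; case: ifP; [right | left].
  apply/negP; rewrite solves; first exact: pair_profile_mix jx jy.
  by move=> i; case: ifP => _; apply: pair_profile_single_peaked.
(* The fooling set is indexed by all sets of pairs. *)
rewrite -(leq_exp2l (m := 2)) // -[X in (2 ^ X <= _)%N]card_ord -cardsT -card_powerset.
apply: (fooling_set_bound (p := p) (F := pair_profile)) => [x _ | x _ | x y _ _].
- exact/(solves _ (sp x))/pair_profile_pareto_optimal.
- exact: short.
- rewrite eqEsubset negb_and => /orP[/mix // | /mix [L mixL noL]].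
  by exists L => // i; case: (mixL i); [right | left].
Qed.

End PairProfile.

Theorem proposition5 :
  exists2 c : rat, 0 < c &
  exists N : nat, forall n : nat, (N <= n)%N ->
  forall (R : finType) (axis : rel R) (pi0 : 'I_n -> R),
    #|R| = n -> strict_linear_order axis -> injective pi0 ->
    c * n%:R <= (checkPO_complexity axis pi0)%:R.
Proof.
(* From [n >= 2] on, [n./2] is at least [n / 3], with equality at [n = 3]; this fails at [n = 1]. *)
exists (1 / 3); first by lra.
exists 2 => n n_ge2 R axis pi0 cardR; subst n => axis_lin pi0_inj.
have [pos pos_bij axisE] := axis_position axis_lin.
have pi0_bij : bijective pi0 by apply: inj_card_bij; rewrite ?card_ord.
rewrite /checkPO_complexity; case: ex_minnP => k /asboolP solv _.
have half_le := pair_profile_bound pos_bij axisE pi0_bij solv.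
have : (#|R| <= 3 * k)%N by lia.
rewrite -(ler_nat rat) natrM; lra.
Qed.
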